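(* Let $D\subset\mathbb{H}^2$ be an open half-space in the hyperbolic plane. Then there is no $\theta$-barrier for $D$, for any finite $\theta\ge 0$.
   Context: $\mathbb{H}^2$ is the hyperbolic plane: the complete simply connected Riemannian 2-manifold of constant sectional curvature $-1$, with metric $\langle\cdot,\cdot\rangle$. For $q\in\mathbb{H}^2$, $\log_q\colon\mathbb{H}^2\to T_q\mathbb{H}^2$ is the inverse of the Riemannian exponential map $\exp_q$. An open half-space is a set of the form $\{p\in\mathbb{H}^2:\langle\log_q(p),v\rangle<0\}$ for some fixed $q\in\mathbb{H}^2$ and nonzero $v\in T_q\mathbb{H}^2$. A set $D\subseteq \mathbb{H}^2$ is geodesically convex (g-convex) if for all $p,q\in D$ the geodesic segment from $p$ to $q$ lies in $D$; half-spaces in $\mathbb{H}^2$ are g-convex. Barriers. Let $D\subseteq\mathbb{H}^2$ be open and g-convex. For a three times continuously differentiable $F\colon D\to\mathbb{R}$, let $\nabla F(p)\in T_p\mathbb{H}^2$ be the Riemannian gradient, $(\nabla^2F)_p$ the Riemannian Hessian (a symmetric bilinear form on $T_p\mathbb{H}^2$), and $(\nabla^3F)_p$ the third covariant derivative, i.e. the covariant derivative of the Hessian (a trilinear form, in general not symmetric). $F$ is strongly $1$-self-concordant if for all $p\in D$ and $u,v,w\in T_p\mathbb{H}^2$, $$|(\nabla^3F)_p(u,v,w)|\le 2\sqrt{(\nabla^2F)_p(u,u)}\sqrt{(\nabla^2F)_p(v,v)}\sqrt{(\nabla^2F)_p(w,w)},$$ and the epigraph $\{(p,t): p\in D,\ t\ge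 F(p)\}$ is a closed subset of $\mathbb{H}^2\times\mathbb{R}$. For a finite real number $\theta\ge 0$, $F$ is a $\theta$-barrier for $D$ if it is strongly $1$-self-concordant, $(\nabla^2F)_p\succ0$ for all $p\in D$, and $\max_{0\neq v\in T_p\mathbb{H}^2}\frac{\langle\nabla F(p),v\rangle}{\sqrt{(\nabla^2F)_p(v,v)}}\le\sqrt\theta$ for all $p\in D$. *)

(* Defs.v *)
From Stdlib Require Import Reals ClassicalEpsilon.
From Coquelicot Require Import Coquelicot.
Open Scope R_scope.

(** The hyperbolic plane is taken in the upper half-plane model: the points
    [(x, y)] of [R * R] with [0 < y], with the metric [(dx^2 + dy^2) / y^2].
    Since one chart covers it, points are pairs of reals, tangent vectors are
    given by their components in the coordinate frame, and tensors by their
    components with respect to the coordinates.  Functions and tensor fields are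
    total on [R * R]; only their values on the relevant open subset of the
    half-plane matter. *)

Definition H2 (p : R * R) : Prop := 0 < snd p.

Variant coord := X1 | X2.

Definition comp (i : coord) (v : R * R) : R :=
  match i with X1 => fst v | X2 => snd v end.

Definition sumc (f : coord -> R) : R := f X1 + f X2.

Definition kron (i j : coord) : R :=
  match i, j with X1, X1 | X2, X2 => 1 | _, _ => 0 end.

Definition ex_partial (i : coord) (f : R * R -> R) (p : R * R) : Prop :=
  match i with
  | X1 => ex_derive (fun x => f (x, snd p)) (fst p)
  | X2 => ex_derive (fun y => f (fst p, y)) (snd p)
  end.

Definition partial (i : coord) (f : R * R -> R) (p : R * R) : R :=
  match i with
  | X1 => Derive (fun x => f (x, snd p)) (fst p)
  | X2 => Derive (fun y => f (fst p, y)) (snd p)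
  end.

Fixpoint Ck (n : nat) (D : R * R -> Prop) (f : R * R -> R) : Prop :=
  (forall p, D p -> continuous f p) /\
  match n with
  | O => True
  | S m => forall i,
      (forall p, D p -> ex_partial i f p) /\ Ck m D (partial i f)
  end.

Definition metric (i j : coord) (p : R * R) : R := kron i j / (snd p) ^ 2.

Definition inv_metric (i j : coord) (p : R * R) : R := kron i j * (snd p) ^ 2.

Definition inner (p u v : R * R) : R :=
  sumc (fun i => sumc (fun j => metric i j p * comp i u * comp j v)).

(** [christoffel k i j] is the symbol with upper index [k] and lower indices
    [i], [j] of the Levi-Civita connection. *)
Definition christoffel (k i j : coord) (p : R * R) : R :=
  / 2 * sumc (fun l => inv_metric k l p *
    (partial i (metric j l) p + partial j (metric i l) p
     - partial l (metric i j) p)).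

Definition velocity (c : R -> R * R) (t : R) : R * R :=
  (Derive (fun s => fst (c s)) t, Derive (fun s => snd (c s)) t).

Definition is_geodesic (c : R -> R * R) : Prop :=
  forall t, H2 (c t) /\
    forall k,
      ex_derive (fun s => comp k (c s)) t /\
      ex_derive (fun s => comp k (velocity c s)) t /\
      Derive (fun s => comp k (velocity c s)) t +
        sumc (fun i => sumc (fun j => christoffel k i j (c t) *
          comp i (velocity c t) * comp j (velocity c t))) = 0.

(** The half-plane is complete, simply connected and negatively curved, so for
    [q] in it a geodesic with the prescribed initial data exists and is unique,
    and [exp_map q] is a bijection from [R * R] onto [H2]: both choices below
    are determined. *)
Definition exp_map (q v : R * R) : R * R :=
  epsilon (inhabits q) (fun p =>
    exists c, is_geodesic c /\ c 0 = q /\ velocity c 0 = v /\ c 1 = p).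

Definition log_map (q p : R * R) : R * R :=
  epsilon (inhabits (0, 0)) (fun v => exp_map q v = p).

Definition open_half_space (D : R * R -> Prop) : Prop :=
  exists q v, H2 q /\ v <> (0, 0) /\
    forall p, D p <-> H2 p /\ inner q (log_map q p) v < 0.

Definition grad (F : R * R -> R) (p : R * R) : R * R :=
  (sumc (fun j => inv_metric X1 j p * partial j F p),
   sumc (fun j => inv_metric X2 j p * partial j F p)).

Definition hess_comp (F : R * R -> R) (i j : coord) (p : R * R) : R :=
  partial i (partial j F) p
  - sumc (fun k => christoffel k i j p * partial k F p).

Definition hess (F : R * R -> R) (p u v : R * R) : R :=
  sumc (fun i => sumc (fun j => hess_comp F i j p * comp i u * comp j v)).

(** Components of the covariant derivative of the Hessian; the direction of
    differentiation is the last index. *)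
Definition third_comp (F : R * R -> R) (i j k : coord) (p : R * R) : R :=
  partial k (hess_comp F i j) p
  - sumc (fun l => christoffel l k i p * hess_comp F l j p)
  - sumc (fun l => christoffel l k j p * hess_comp F i l p).

Definition third (F : R * R -> R) (p u v w : R * R) : R :=
  sumc (fun i => sumc (fun j => sumc (fun k =>
    third_comp F i j k p * comp i u * comp j v * comp k w))).

Definition epigraph (D : R * R -> Prop) (F : R * R -> R)
    (z : R * R * R) : Prop :=
  D (fst z) /\ F (fst z) <= snd z.

(** Closedness in the subspace [H2 * R], not in [R * R * R]. *)
Definition closed_in_H2xR (E : R * R * R -> Prop) : Prop :=
  exists C : R * R * R -> Prop, closed C /\
    forall z, E z <-> H2 (fst z) /\ C z.

Definition strongly_self_concordant (D : R * R -> Prop) (F : R * R -> R)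
    : Prop :=
  Ck 3 D F /\
  (forall p u v w, D p ->
     Rabs (third F p u v w) <=
       2 * sqrt (hess F p u u) * sqrt (hess F p v v) * sqrt (hess F p w w)) /\
  closed_in_H2xR (epigraph D F).

Definition is_barrier (theta : R) (D : R * R -> Prop) (F : R * R -> R)
    : Prop :=
  strongly_self_concordant D F /\
  (forall p v, D p -> v <> (0, 0) -> 0 < hess F p v v) /\
  (forall p v, D p -> v <> (0, 0) ->
     inner p (grad F p) v / sqrt (hess F p v v) <= sqrt theta).

(* Main.v *)
Require Import Defs.
From Stdlib Require Import Reals Lra Psatz ClassicalEpsilon.
From Coquelicot Require Import Coquelicot.
Open Scope R_scope.

(** An open half-space contains a complete geodesic [c].  Along it
    [g = (F o c)'] satisfies [g' = Hess F (c', c') > 0], and the gradient bound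
    gives [g^2 <= theta g'].  Since [g] is not identically zero, this Riccati
    inequality makes [g] blow up in finite forward or backward time, which is
    absurd.

    To recognize points of the half-space, note that a linear form on the
    hyperboloid restricts along a geodesic of energy [E] to a solution of
    [g'' = E g].  Such a solution with [g 0 = 0] has the sign of [g' 0], so the
    sign of [inner q (log_map q p) v] is that of a linear form at [p].  The same
    linear equation gives uniqueness of geodesics, hence determines
    [exp_map]. *)

(** * Monotonicity and the scalar equation [g'' = E g] *)

Lemma is_derive_nonneg_le (f f' : R -> R) (a b : R) :
  (forall t, is_derive f t (f' t)) -> (forall t, 0 <= f' t) ->
  a <= b -> f a <= f b.
Proof.
  intros Hf Hpos Hab.
  destruct (MVT_gen f a b f') as [t [_ Ht]].
  - intros; apply Hf.
  - intros t _; apply derivable_continuous_pt.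
    exists (f' t); apply is_derive_Reals, Hf.
  - specialize (Hpos t); nra.
Qed.

Lemma is_derive_0_const (f : R -> R) (a b : R) :
  (forall t, is_derive f t 0) -> f a = f b.
Proof.
  intros Hf.
  destruct (MVT_gen f a b (fun _ => 0)) as [t [_ Ht]].
  - intros; apply Hf.
  - intros t _; apply derivable_continuous_pt.
    exists 0; apply is_derive_Reals, Hf.
  - lra.
Qed.

(** With [k = sqrt E], the function [(g' + k g) exp (- k t)] is constant, so
    [(g exp (k t))' = g' 0 * exp (2 k t)]. *)
Lemma hyperbolic_ode_nonneg (g g' : R -> R) (E : R) :
  0 <= E ->
  (forall t, is_derive g t (g' t)) -> (forall t, is_derive g' t (E * g t)) ->
  g 0 = 0 -> 0 <= g' 0 -> 0 <= g 1.
Proof.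
  intros HE Hg Hg' H0 H0'.
  set (k := sqrt E).
  assert (Hk : k * k = E) by (apply sqrt_sqrt; exact HE).
  assert (Hphi : forall t, (g' t + k * g t) * exp (- k * t) = g' 0).
  { intros t.
    transitivity ((g' 0 + k * g 0) * exp (- k * 0)).
    - apply (is_derive_0_const (fun t => (g' t + k * g t) * exp (- k * t))).
      intros s; auto_derive.
      + repeat split; eexists; [apply Hg' | apply Hg].
      + rewrite (is_derive_unique (fun x : R => g' x) _ _ (Hg' s)),
          (is_derive_unique (fun x : R => g x) _ _ (Hg s)), <- Hk; ring.
    - rewrite H0, Rmult_0_r, Rmult_0_r, exp_0; ring. }
  assert (Hle : g 0 * exp (k * 0) <= g 1 * exp (k * 1)).
  { apply (is_derive_nonneg_le (fun t => g t * exp (k * t))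
             (fun t => (g' t + k * g t) * exp (k * t))); [| | lra].
    - intros s; auto_derive.
      + eexists; apply Hg.
      + rewrite (is_derive_unique (fun x : R => g x) _ _ (Hg s)); ring.
    - intros s.
      assert (He : g' s + k * g s = g' 0 * exp (k * s)).
      { rewrite <- (Hphi s), Rmult_assoc, <- exp_plus.
        replace (- k * s + k * s) with 0 by ring.
        rewrite exp_0; ring. }
      rewrite He.
      pose proof (exp_pos (k * s)).
      apply Rmult_le_pos; [apply Rmult_le_pos |]; lra. }
  rewrite H0, Rmult_0_l in Hle.
  pose proof (exp_pos (k * 1)); nra.
Qed.

(** The difference of the two solutions starts at zero with zero slope, so [hyperbolic_ode_nonneg]
    applies to it with either sign. *)
Lemma hyperbolic_ode_unique (g g' h h' : R -> R) (E : R) :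
  0 <= E ->
  (forall t, is_derive g t (g' t)) -> (forall t, is_derive g' t (E * g t)) ->
  (forall t, is_derive h t (h' t)) -> (forall t, is_derive h' t (E * h t)) ->
  g 0 = h 0 -> g' 0 = h' 0 -> g 1 = h 1.
Proof.
  assert (Hle : forall g g' h h' : R -> R, 0 <= E ->
    (forall t, is_derive g t (g' t)) -> (forall t, is_derive g' t (E * g t)) ->
    (forall t, is_derive h t (h' t)) -> (forall t, is_derive h' t (E * h t)) ->
    g 0 = h 0 -> g' 0 = h' 0 -> h 1 <= g 1).
  { clear; intros g g' h h' HE Hg Hg' Hh Hh' H0 H0'.
    assert (H : 0 <= g 1 - h 1); [| lra].
    apply (hyperbolic_ode_nonneg (fun t => g t - h t) (fun t => g' t - h' t) E);
      try lra; intros t.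
    - apply (is_derive_minus g h t _ _ (Hg t) (Hh t)).
    - rewrite Rmult_minus_distr_l.
      apply (is_derive_minus g' h' t _ _ (Hg' t) (Hh' t)). }
  intros; apply Rle_antisym.
  - apply (Hle h h' g g'); auto.
  - apply (Hle g g' h h'); auto.
Qed.

(** * Christoffel symbols and the geodesic equation in coordinates *)

Lemma partial_metric (l i j : coord) (p : R * R) :
  H2 p ->
  partial l (metric i j) p =
  match l with X1 => 0 | X2 => - 2 * kron i j / snd p ^ 3 end.
Proof.
  unfold H2; destruct p as [x y]; simpl; intros Hy.
  unfold metric; destruct l; unfold partial; simpl.
  - apply Derive_const.
  - apply is_derive_unique; auto_derive.
    + nra.
    + field; lra.
Qed.

Lemma christoffel_H2 (k i j : coord) (p : R * R) :
  H2 p ->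
  christoffel k i j p =
  match k, i, j with
  | X1, X1, X2 | X1, X2, X1 | X2, X2, X2 => - / snd p
  | X2, X1, X1 => / snd p
  | _, _, _ => 0
  end.
Proof.
  intros Hp; unfold christoffel, sumc.
  rewrite !partial_metric by exact Hp.
  unfold H2 in Hp; unfold inv_metric.
  destruct k, i, j; simpl; field; lra.
Qed.

(** The geodesic equation with the Christoffel symbols evaluated. Velocities are separate arguments,
    so that explicit formulas can stand for them in place of [Derive]. *)
Definition geodesic_coords (x y x' y' : R -> R) : Prop :=
  forall t, 0 < y t /\ is_derive x t (x' t) /\ is_derive y t (y' t) /\
    is_derive x' t (2 * x' t * y' t / y t) /\
    is_derive y' t ((y' t ^ 2 - x' t ^ 2) / y t).

Lemma is_geodesic_coords (c : R -> R * R) :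
  is_geodesic c ->
  geodesic_coords (fun t => fst (c t)) (fun t => snd (c t))
    (fun t => fst (velocity c t)) (fun t => snd (velocity c t)).
Proof.
  intros Hc t; destruct (Hc t) as [Hp Hk].
  destruct (Hk X1) as (Ex1 & Ex2 & Hx); destruct (Hk X2) as (Ey1 & Ey2 & Hy).
  unfold sumc in Hx, Hy; rewrite !christoffel_H2 in Hx, Hy by exact Hp.
  unfold H2 in Hp; simpl in *.
  refine (conj _ (conj _ (conj _ (conj _ _)))).
  - exact Hp.
  - apply Derive_correct, Ex1.
  - apply Derive_correct, Ey1.
  - match goal with |- is_derive _ _ ?l =>
      replace l with (Derive (fun s => Derive (fun u => fst (c u)) s) t) end.
    + apply Derive_correct, Ex2.
    + eapply Rplus_eq_reg_r, (eq_trans Hx); field; lra.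
  - match goal with |- is_derive _ _ ?l =>
      replace l with (Derive (fun s => Derive (fun u => snd (c u)) s) t) end.
    + apply Derive_correct, Ey2.
    + eapply Rplus_eq_reg_r, (eq_trans Hy); field; lra.
Qed.

Lemma coords_velocity (x y x' y' : R -> R) (t : R) :
  geodesic_coords x y x' y' ->
  velocity (fun t => (x t, y t)) t = (x' t, y' t).
Proof.
  intros H; unfold velocity; simpl; f_equal; apply is_derive_unique, H.
Qed.

Lemma coords_is_geodesic (x y x' y' : R -> R) :
  geodesic_coords x y x' y' -> is_geodesic (fun t => (x t, y t)).
Proof.
  intros H t.
  destruct (H t) as (Hy & Hx1 & Hy1 & Hx2 & Hy2).
  split; [exact Hy |].
  assert (Hv : forall k s, Defs.comp k (velocity (fun t => (x t, y t)) s)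
                           = Defs.comp k (x' s, y' s)).
  { intros k s; f_equal; apply coords_velocity, H. }
  intros k; split; [| split].
  - destruct k; eexists; [exact Hx1 | exact Hy1].
  - apply (ex_derive_ext (fun s => Defs.comp k (x' s, y' s))); [easy |].
    destruct k; eexists; [exact Hx2 | exact Hy2].
  - rewrite (Derive_ext _ _ t (Hv k)).
    unfold sumc; rewrite !Hv, !christoffel_H2 by exact Hy.
    destruct k; simpl;
      [rewrite (is_derive_unique (fun s : R => x' s) _ _ Hx2)
      |rewrite (is_derive_unique (fun s : R => y' s) _ _ Hy2)]; field; lra.
Qed.

(** * Energy, linear forms along geodesics, and uniqueness *)

(** The conserved quantity is the squared Riemannian speed; it supplies the constant [E] of
    [g'' = E g]. *)
Lemma energy_const (x y x' y' : R -> R) (t : R) :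
  geodesic_coords x y x' y' ->
  (x' t ^ 2 + y' t ^ 2) / y t ^ 2 = (x' 0 ^ 2 + y' 0 ^ 2) / y 0 ^ 2.
Proof.
  intros H.
  apply (is_derive_0_const (fun t => (x' t ^ 2 + y' t ^ 2) / y t ^ 2)).
  intros s; destruct (H s) as (Hy & Hx1 & Hy1 & Hx2 & Hy2).
  auto_derive.
  - repeat split; try (eexists; eassumption). nra.
  - rewrite (is_derive_unique (fun s : R => x' s) _ _ Hx2),
      (is_derive_unique (fun s : R => y' s) _ _ Hy2),
      (is_derive_unique (fun s : R => y s) _ _ Hy1); field; lra.
Qed.

(** The functions [1/y], [x/y] and [(x^2 + y^2)/y] span the restrictions of
    linear forms to the hyperboloid. *)
Definition linear_form (A B C : R) (p : R * R) : R :=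
  (A + B * fst p + C * (fst p ^ 2 + snd p ^ 2)) / snd p.

Definition linear_form' (A B C : R) (p v : R * R) : R :=
  (B * fst v + 2 * C * (fst p * fst v + snd p * snd v)) / snd p
  - (A + B * fst p + C * (fst p ^ 2 + snd p ^ 2)) * snd v / snd p ^ 2.

Lemma linear_form_derive (A B C : R) (x y x' y' : R -> R) (t : R) :
  geodesic_coords x y x' y' ->
  is_derive (fun t => linear_form A B C (x t, y t)) t
    (linear_form' A B C (x t, y t) (x' t, y' t)).
Proof.
  intros H; destruct (H t) as (Hy & Hx1 & Hy1 & Hx2 & Hy2).
  unfold linear_form, linear_form'; simpl.
  auto_derive.
  - repeat split; try (eexists; eassumption). lra.
  - rewrite (is_derive_unique (fun s : R => x s) _ _ Hx1),
      (is_derive_unique (fun s : R => y s) _ _ Hy1); field; lra.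
Qed.

Lemma linear_form_derive2 (A B C : R) (x y x' y' : R -> R) (t : R) :
  geodesic_coords x y x' y' ->
  is_derive (fun t => linear_form' A B C (x t, y t) (x' t, y' t)) t
    ((x' 0 ^ 2 + y' 0 ^ 2) / y 0 ^ 2 * linear_form A B C (x t, y t)).
Proof.
  intros H; destruct (H t) as (Hy & Hx1 & Hy1 & Hx2 & Hy2).
  rewrite <- (energy_const x y x' y' t H).
  unfold linear_form, linear_form'; simpl.
  auto_derive.
  - repeat split; try (eexists; eassumption); nra.
  - rewrite (is_derive_unique (fun s : R => x s) _ _ Hx1),
      (is_derive_unique (fun s : R => y s) _ _ Hy1),
      (is_derive_unique (fun s : R => x' s) _ _ Hx2),
      (is_derive_unique (fun s : R => y' s) _ _ Hy2); field; lra.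
Qed.

Lemma energy_nonneg (a b c : R) : 0 < c -> 0 <= (a ^ 2 + b ^ 2) / c ^ 2.
Proof.
  intros Hc; apply Rmult_le_pos; [nra |].
  apply Rlt_le, Rinv_0_lt_compat; nra.
Qed.

(** The two linear forms [1/y] and [x/y] already determine a point, and their values at time 1
    follow from the initial data by [hyperbolic_ode_unique]. *)
Lemma geodesic_unique (c d : R -> R * R) :
  is_geodesic c -> is_geodesic d ->
  c 0 = d 0 -> velocity c 0 = velocity d 0 -> c 1 = d 1.
Proof.
  intros Hc Hd H0 Hv.
  apply is_geodesic_coords in Hc; apply is_geodesic_coords in Hd.
  assert (Hy : forall A B, linear_form A B 0 (c 1) = linear_form A B 0 (d 1)).
  { intros A B.
    rewrite (surjective_pairing (c 1)), (surjective_pairing (d 1)).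
    eapply (hyperbolic_ode_unique _ _ _ _ _ _
      (fun t => linear_form_derive A B 0 _ _ _ _ t Hc)
      (fun t => linear_form_derive2 A B 0 _ _ _ _ t Hc)
      (fun t => linear_form_derive A B 0 _ _ _ _ t Hd)).
    (* Equal initial data give both geodesics the same energy, hence the same scalar equation. *)
    - intros t; rewrite H0, Hv.
      apply (linear_form_derive2 A B 0 _ _ _ _ t Hd).
    - rewrite H0; reflexivity.
    - rewrite H0, Hv; reflexivity.
    Unshelve. apply energy_nonneg, (Hc 0). }
  pose proof (Hy 1 0) as Ha; pose proof (Hy 0 1) as Hb.
  destruct (Hc 1) as [Hc1 _]; destruct (Hd 1) as [Hd1 _].
  unfold linear_form in Ha, Hb.
  destruct (c 1) as [x1 y1], (d 1) as [x2 y2]; simpl in *.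
  assert (Hyy : y1 = y2).
  { apply Rinv_eq_reg.
    replace (/ y1) with ((1 + 0 * x1 + 0 * (x1 * (x1 * 1) + y1 * (y1 * 1))) / y1)
      by (field; lra).
    rewrite Ha; field; lra. }
  subst y2; f_equal.
  apply (Rmult_eq_reg_r (/ y1)); [| apply Rinv_neq_0_compat; lra].
  match type of Hb with ?l = ?r =>
    replace (x1 * / y1) with l by (field; lra);
    replace (x2 * / y1) with r by (field; lra) end.
  exact Hb.
Qed.

(** * Explicit geodesics with given initial data or given endpoints *)

Lemma vertical_geodesic (x0 y0 k : R) :
  0 < y0 ->
  geodesic_coords (fun _ => x0) (fun t => y0 * exp (k * t))
    (fun _ => 0) (fun t => k * (y0 * exp (k * t))).
Proof.
  intros Hy t.
  assert (Hp : 0 < y0 * exp (k * t))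
    by (apply Rmult_lt_0_compat; [exact Hy | apply exp_pos]).
  pose proof (exp_pos (k * t)).
  refine (conj Hp (conj _ (conj _ (conj _ _)))); auto_derive; trivial;
    field; lra.
Qed.

Definition arc_x (m r e : R) : R := m + r * (e ^ 2 - 1) / (e ^ 2 + 1).

Definition arc_y (r e : R) : R := 2 * r * e / (e ^ 2 + 1).

(** The half-circle of centre [(m, 0)] and radius [r], usually written
    [(m + r tanh s, r / cosh s)] with [s] affine in [t]; here [exp s] is
    [e * exp (k * t)]. *)
Lemma arc_geodesic (m r e k : R) :
  0 < r -> 0 < e ->
  geodesic_coords
    (fun t => arc_x m r (e * exp (k * t))) (fun t => arc_y r (e * exp (k * t)))
    (fun t => k * arc_y r (e * exp (k * t)) ^ 2 / r)
    (fun t => - k * arc_y r (e * exp (k * t))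
                * (arc_x m r (e * exp (k * t)) - m) / r).
Proof.
  intros Hr He t; unfold arc_x, arc_y.
  pose proof (exp_pos (k * t)) as Hp.
  assert (Hq : 0 < e * exp (k * t)) by (apply Rmult_lt_0_compat; assumption).
  assert (Hn : e * exp (k * t) * (e * exp (k * t) * 1) + 1 <> 0) by nra.
  refine (conj _ (conj _ (conj _ (conj _ _)))).
  - apply Rmult_lt_0_compat; [nra | apply Rinv_0_lt_compat; nra].
  - auto_derive; [exact Hn | field; nra].
  - auto_derive; [exact Hn | field; nra].
  - auto_derive; [exact Hn | field; nra].
  - auto_derive; [repeat split; exact Hn | field; nra].
Qed.

(** With [tanh s = (x - m) / r] and [1 / cosh s = y / r], the parameter is [exp s = cosh s + sinh s
    = (r + x - m) / y]. *)
Lemma arc_point (m r x y : R) :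
  0 < r -> 0 < y -> (x - m) ^ 2 + y ^ 2 = r ^ 2 ->
  let e := (r + x - m) / y in 0 < e /\ arc_x m r e = x /\ arc_y r e = y.
Proof.
  intros Hr Hy H e.
  (* Since [y] is positive, the circle equation forces [|x - m| < r]. *)
  assert (Hs : 0 < r + x - m) by nra.
  assert (He : 0 < e).
  { apply Rmult_lt_0_compat; [exact Hs | apply Rinv_0_lt_compat, Hy]. }
  assert (Hden : e ^ 2 + 1 = 2 * r * (r + x - m) / y ^ 2).
  { unfold e.
    replace (2 * r * (r + x - m))
      with ((r + x - m) ^ 2 + (r ^ 2 - (x - m) ^ 2)) by ring.
    rewrite <- H; field; lra. }
  assert (Hnum : e ^ 2 - 1 = 2 * (x - m) * (r + x - m) / y ^ 2).
  { replace (e ^ 2 - 1) with (e ^ 2 + 1 - 2) by ring; rewrite Hden.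
    replace 2 with (2 * (r ^ 2 - (x - m) ^ 2) / y ^ 2) at 2
      by (rewrite <- H; field; lra).
    field; lra. }
  split; [exact He |].
  unfold arc_x, arc_y; rewrite Hden, ?Hnum; unfold e.
  split; field; lra.
Qed.

Lemma geodesic_exists (q u : R * R) :
  H2 q -> exists c, is_geodesic c /\ c 0 = q /\ velocity c 0 = u.
Proof.
  destruct q as [x0 y0], u as [u1 u2]; unfold H2; simpl; intros Hy.
  destruct (Req_dec u1 0) as [-> | Hu].
  - pose proof (vertical_geodesic x0 y0 (u2 / y0) Hy) as Hg.
    exists (fun t => (x0, y0 * exp (u2 / y0 * t))).
    split; [eapply coords_is_geodesic, Hg |].
    rewrite (coords_velocity _ _ _ _ 0 Hg), Rmult_0_r, exp_0.
    split; f_equal; field; lra.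
  (* The centre [(m, 0)] lies where the Euclidean normal to [u] at [q] meets the boundary line, and
     [r] is its distance to [q]. *)
  - set (z := - u2 / u1).
    set (r := y0 * sqrt (1 + z ^ 2)).
    set (m := x0 - y0 * z).
    assert (Hr : 0 < r).
    { apply Rmult_lt_0_compat; [exact Hy | apply sqrt_lt_R0; nra]. }
    assert (Hc : (x0 - m) ^ 2 + y0 ^ 2 = r ^ 2).
    { unfold r; rewrite Rpow_mult_distr, pow2_sqrt by nra; unfold m; ring. }
    destruct (arc_point m r x0 y0 Hr Hy Hc) as (He & Hx0 & Hy0).
    set (e := (r + x0 - m) / y0) in *.
    (* This rate makes the initial horizontal velocity [k * y0 ^ 2 / r] equal to [u1]. *)
    set (k := u1 * r / y0 ^ 2).
    pose proof (arc_geodesic m r e k Hr He) as Hg.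
    exists (fun t => (arc_x m r (e * exp (k * t)), arc_y r (e * exp (k * t)))).
    split; [eapply coords_is_geodesic, Hg |].
    rewrite (coords_velocity _ _ _ _ 0 Hg), Rmult_0_r, exp_0, Rmult_1_r,
      Hx0, Hy0.
    split; [reflexivity |].
    unfold k, m, z; f_equal; field; lra.
Qed.

Lemma geodesic_connects (p q : R * R) :
  H2 p -> H2 q -> exists c, is_geodesic c /\ c 0 = q /\ c 1 = p.
Proof.
  destruct p as [x1 y1], q as [x0 y0]; unfold H2; simpl; intros Hy1 Hy0.
  destruct (Req_dec x1 x0) as [-> | Hx].
  - pose proof (vertical_geodesic x0 y0 (ln (y1 / y0)) Hy0) as Hg.
    exists (fun t => (x0, y0 * exp (ln (y1 / y0) * t))).
    split; [eapply coords_is_geodesic, Hg |].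
    rewrite Rmult_0_r, exp_0, !Rmult_1_r, exp_ln.
    + split; f_equal; field; lra.
    + apply Rmult_lt_0_compat; [exact Hy1 | apply Rinv_0_lt_compat, Hy0].
  (* The centre is equidistant from both points: the perpendicular bisector meets the boundary line
     there. *)
  - set (m := (x1 ^ 2 + y1 ^ 2 - x0 ^ 2 - y0 ^ 2) / (2 * (x1 - x0))).
    set (r := sqrt ((x0 - m) ^ 2 + y0 ^ 2)).
    assert (Hr : 0 < r).
    { apply sqrt_lt_R0, Rplus_le_lt_0_compat;
        [apply pow2_ge_0 | apply pow_lt, Hy0]. }
    assert (Hc0 : (x0 - m) ^ 2 + y0 ^ 2 = r ^ 2)
      by (unfold r; rewrite pow2_sqrt;
          [reflexivity | apply Rplus_le_le_0_compat; apply pow2_ge_0]).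
    assert (Hc1 : (x1 - m) ^ 2 + y1 ^ 2 = r ^ 2)
      by (rewrite <- Hc0; unfold m; field; lra).
    destruct (arc_point m r x0 y0 Hr Hy0 Hc0) as (He0 & Hx0' & Hy0').
    destruct (arc_point m r x1 y1 Hr Hy1 Hc1) as (He1 & Hx1' & Hy1').
    set (e0 := (r + x0 - m) / y0) in *.
    set (e1 := (r + x1 - m) / y1) in *.
    (* The rate [ln (e1 / e0)] moves the parameter from [e0] at time 0 to [e1] at time 1. *)
    pose proof (arc_geodesic m r e0 (ln (e1 / e0)) Hr He0) as Hg.
    eexists; split; [eapply coords_is_geodesic, Hg |]; simpl.
    rewrite Rmult_0_r, exp_0, !Rmult_1_r, exp_ln.
    + replace (e0 * (e1 / e0)) with e1 by (field; lra).
      rewrite Hx0', Hy0', Hx1', Hy1'; auto.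
    + apply Rmult_lt_0_compat; [exact He1 | apply Rinv_0_lt_compat, He0].
Qed.

(** * The exponential map and the logarithm *)

(** The curve [c] witnesses that the choice has a solution, and [geodesic_unique] identifies the
    chosen endpoint with [c 1]. *)
Lemma exp_map_geodesic (c : R -> R * R) :
  is_geodesic c -> exp_map (c 0) (velocity c 0) = c 1.
Proof.
  intros Hc; unfold exp_map.
  match goal with |- epsilon ?i ?P = _ =>
    destruct (epsilon_spec i P) as (d & Hd & Hd0 & Hdv & <-) end.
  - exists (c 1), c; auto.
  - apply geodesic_unique; auto.
Qed.

(** A connecting geodesic gives [p] a preimage under [exp_map q], so [log_map q p] is such a
    preimage; the geodesic launched with it must then end at [p]. *)
Lemma log_map_geodesic (q p : R * R) :
  H2 q -> H2 p ->
  exists c, is_geodesic c /\ c 0 = q /\ velocity c 0 = log_map q p /\ c 1 = p.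
Proof.
  intros Hq Hp.
  assert (Hlog : exp_map q (log_map q p) = p).
  { unfold log_map; apply epsilon_spec.
    destruct (geodesic_connects p q Hp Hq) as (c & Hc & <- & <-).
    exists (velocity c 0); apply exp_map_geodesic, Hc. }
  destruct (geodesic_exists q (log_map q p) Hq) as (c & Hc & H0 & Hv).
  exists c; refine (conj Hc (conj H0 (conj Hv _))).
  rewrite <- (exp_map_geodesic c Hc), H0, Hv; exact Hlog.
Qed.

(** * Half-spaces described by linear forms *)

(** Up to the factor [2 * y0 ^ 2 * y], this is the linear form that vanishes at
    [q = (x0, y0)] and whose differential there is [inner q _ v]. *)
Definition half_space_form (q v p : R * R) : R :=
  2 * snd q * fst v * (fst p - fst q)
  + snd v * ((fst p - fst q) ^ 2 + snd p ^ 2 - snd q ^ 2).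

(** By contraposition: if the inner product is nonnegative, the form along the geodesic from [q] to
    [p] starts at zero with nonnegative slope, so it is nonnegative at [p]. *)
Lemma half_space_form_neg (q v p : R * R) :
  H2 q -> H2 p -> half_space_form q v p < 0 -> inner q (log_map q p) v < 0.
Proof.
  intros Hq Hp HN.
  apply Rnot_le_lt; intros Hge; apply (Rlt_not_le _ _ HN).
  destruct (log_map_geodesic q p Hq Hp) as (c & Hc & H0 & Hv & H1).
  rewrite <- Hv in Hge; clear HN Hv; subst q p.
  apply is_geodesic_coords in Hc.
  set (x0 := fst (c 0)) in *; set (y0 := snd (c 0)) in *.
  (* Expanding [half_space_form] in [1], [x] and [x^2 + y^2] gives the coefficients [A], [B] and
     [snd v]. *)
  set (A := - 2 * y0 * fst v * x0 + snd v * (x0 ^ 2 - y0 ^ 2)).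
  set (B := 2 * y0 * fst v - 2 * snd v * x0).
  assert (Hl : forall p, H2 p ->
    half_space_form (c 0) v p = linear_form A B (snd v) p * snd p).
  { unfold H2; intros p Hp'; unfold linear_form, half_space_form, A, B.
    fold x0 y0; field; lra. }
  rewrite (Hl _ Hp).
  unfold H2 in Hp, Hq; fold y0 in Hq.
  apply Rmult_le_pos; [| lra].
  rewrite (surjective_pairing (c 1)).
  apply (hyperbolic_ode_nonneg _ _ _ (energy_nonneg _ _ _ Hq)
    (fun t => linear_form_derive A B (snd v) _ _ _ _ t Hc)
    (fun t => linear_form_derive2 A B (snd v) _ _ _ _ t Hc)).
  - unfold linear_form; simpl; fold x0 y0; unfold A, B; field; lra.
  - cbv beta; unfold linear_form'; cbn [fst snd]; fold x0 y0.
    match goal with |- 0 <= ?l =>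
      replace l with (2 * y0 ^ 2 * inner (c 0) (velocity c 0) v) end.
    + apply Rmult_le_pos; [nra | exact Hge].
    + unfold inner, sumc, metric, Defs.comp, kron; fold y0; unfold A, B.
      field; lra.
Qed.

(** This provides the neighbourhoods inside [D] on which the chain rule for [F] relies. *)
Lemma half_space_form_open (q v p : R * R) :
  H2 p -> half_space_form q v p < 0 ->
  locally p (fun z => H2 z /\ half_space_form q v z < 0).
Proof.
  destruct p as [x y]; intros Hp HN; apply filter_and.
  - apply (proj1 (continuity_2d_pt_filterlim (fun _ v => v) x y)
             (continuity_2d_pt_id2 x y) (fun y => 0 < y)).
    exact (open_gt 0 y Hp).
  - apply (proj1 (continuity_2d_pt_filterlim
                    (fun x y => half_space_form q v (x, y)) x y))
      with (P := fun r => r < 0).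
    + unfold half_space_form; simpl.
      repeat first
        [ apply continuity_2d_pt_plus | apply continuity_2d_pt_minus
        | apply continuity_2d_pt_mult | apply continuity_2d_pt_id1
        | apply continuity_2d_pt_id2 | apply continuity_2d_pt_const ].
    + exact (open_lt 0 _ HN).
Qed.

(** * Derivatives of a function along a geodesic *)

(** Total differentiability comes from the first partial existing nearby and being continuous at the
    point, together with the second partial existing there. *)
Lemma chain_rule (D : R * R -> Prop) (F : R * R -> R) (x y : R -> R)
    (t x' y' : R) :
  Ck 1 D F -> locally (x t, y t) D ->
  is_derive x t x' -> is_derive y t y' ->
  is_derive (fun t => F (x t, y t)) t
    (partial X1 F (x t, y t) * x' + partial X2 F (x t, y t) * y').
Proof.
  intros [_ HF] HD Hx Hy.
  destruct (HF X1) as [HF1 [HC1 _]]; destruct (HF X2) as [HF2 _].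
  apply is_derive_Reals.
  apply (derivable_pt_lim_comp_2d (fun x y => F (x, y))).
  - apply filterdiff_differentiable_pt_lim.
    apply (is_derive_filterdiff (fun x y => F (x, y)) (x t) (y t)
             (fun x y => partial X1 F (x, y))).
    + apply (filter_imp D); [| exact HD].
      intros [a b] Hab; apply Derive_correct, (HF1 _ Hab).
    + apply Derive_correct, (HF2 _ (locally_singleton _ _ HD)).
    + apply (continuous_ext (partial X1 F)); [now intros [a b] |].
      apply HC1, (locally_singleton _ _ HD).
  - apply is_derive_Reals, Hx.
  - apply is_derive_Reals, Hy.
Qed.

Definition dir_deriv (F : R * R -> R) (p v : R * R) : R :=
  partial X1 F p * fst v + partial X2 F p * snd v.

Lemma inner_grad (F : R * R -> R) (p v : R * R) :
  H2 p -> inner p (grad F p) v = dir_deriv F p v.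
Proof.
  unfold H2, inner, grad, sumc, metric, inv_metric, dir_deriv; simpl.
  intros Hp; field; lra.
Qed.

(** The acceleration terms of the second derivative and the Christoffel terms
    of the Hessian cancel by the geodesic equation. *)
Lemma dir_deriv_geodesic (D : R * R -> Prop) (F : R * R -> R)
    (x y x' y' : R -> R) (t : R) :
  Ck 2 D F -> locally (x t, y t) D -> geodesic_coords x y x' y' ->
  is_derive (fun t => dir_deriv F (x t, y t) (x' t, y' t)) t
    (hess F (x t, y t) (x' t, y' t) (x' t, y' t)).
Proof.
  intros [_ HF] HD H; destruct (H t) as (Hy & Hx1 & Hy1 & Hx2 & Hy2).
  pose proof (fun i => chain_rule D (partial i F) x y t _ _
                         (proj2 (HF i)) HD Hx1 Hy1) as Hc.
  evar_last.
  - exact (is_derive_plus (fun t => partial X1 F (x t, y t) * x' t)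
             (fun t => partial X2 F (x t, y t) * y' t) t _ _
             (is_derive_mult (fun t => partial X1 F (x t, y t)) x' t _ _
                (Hc X1) Hx2 Rmult_comm)
             (is_derive_mult (fun t => partial X2 F (x t, y t)) y' t _ _
                (Hc X2) Hy2 Rmult_comm)).
  - unfold plus, mult; simpl.
    unfold hess, hess_comp, sumc; rewrite !christoffel_H2 by exact Hy.
    simpl; field; lra.
Qed.

(** * The Riccati inequality and its application to barriers *)

(** If [g a] were positive, [g] would stay positive after [a] and [- / g] would have slope at least
    [/ theta]. Over a time [theta / g a] it would climb from [- / g a] to at least zero, yet it
    remains negative. *)
Lemma riccati_no_global_pos (g g' : R -> R) (theta a : R) :
  (forall t, is_derive g t (g' t)) -> (forall t, 0 < g' t) ->
  (forall t, g t ^ 2 <= theta * g' t) -> g a <= 0.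
Proof.
  intros Hg Hpos Hle.
  apply Rnot_lt_le; intros Ha.
  assert (Hth : 0 < theta) by (specialize (Hle a); specialize (Hpos a); nra).
  assert (Hmono : forall t, a <= t -> g a <= g t).
  { intros t; apply (is_derive_nonneg_le g g'); [exact Hg |].
    intros s; apply Rlt_le, Hpos. }
  set (b := a + theta / g a).
  assert (HT : 0 < theta / g a)
    by (apply Rmult_lt_0_compat; [exact Hth | apply Rinv_0_lt_compat, Ha]).
  assert (Hd : forall t, a <= t ->
    is_derive (fun t => - / g t) t (g' t / g t ^ 2)).
  { intros t Ht; specialize (Hmono t Ht).
    auto_derive.
    - split; [eexists; apply Hg | split; [lra | trivial]].
    - rewrite (is_derive_unique (fun x : R => g x) _ _ (Hg t)); field; lra. }
  destruct (MVT_gen (fun t => - / g t) a b (fun t => g' t / g t ^ 2))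
    as [c [Hc Heq]]; rewrite ?Rmin_left, ?Rmax_right in * by (unfold b; lra).
  - intros t Ht; apply Hd; lra.
  - intros t Ht; apply derivable_continuous_pt.
    eexists; apply is_derive_Reals, Hd; lra.
  - assert (Hgc : 0 < g c) by (specialize (Hmono c); lra).
    assert (Hgb : 0 < / g b).
    { apply Rinv_0_lt_compat; specialize (Hmono b); unfold b in *; lra. }
    assert (Hslope : / theta <= g' c / g c ^ 2).
    { apply (Rmult_le_reg_r (theta * g c ^ 2));
        [apply Rmult_lt_0_compat, pow_lt; assumption |].
      replace (/ theta * (theta * g c ^ 2)) with (g c ^ 2) by (field; lra).
      replace (g' c / g c ^ 2 * (theta * g c ^ 2)) with (theta * g' c)
        by (field; lra).
      apply Hle. }
    assert (Hstep : / g a <= g' c / g c ^ 2 * (b - a)).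
    { replace (/ g a) with (/ theta * (b - a)) by (unfold b; field; lra).
      apply Rmult_le_compat_r; [unfold b; lra | exact Hslope]. }
    lra.
Qed.

(** The time reversal [- g (- t)] satisfies the same inequality, so [g] vanishes identically,
    against [0 < g']. *)
Lemma riccati_no_global (g g' : R -> R) (theta : R) :
  (forall t, is_derive g t (g' t)) -> (forall t, 0 < g' t) ->
  (forall t, g t ^ 2 <= theta * g' t) -> False.
Proof.
  intros Hg Hpos Hle.
  assert (H0 : forall a, g a = 0).
  { intros a; apply Rle_antisym.
    - apply (riccati_no_global_pos g g' theta); assumption.
    - assert (- g (- - a) <= 0); [| rewrite Ropp_involutive in *; lra].
      apply (riccati_no_global_pos (fun t => - g (- t)) (fun t => g' (- t))
               theta); intros t.
      + auto_derive.
        * eexists; apply Hg.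
        * rewrite (is_derive_unique (fun x : R => g x) _ _ (Hg (- t))); ring.
      + apply Hpos.
      + specialize (Hle (- t)); lra. }
  specialize (Hpos 0).
  rewrite <- (is_derive_unique _ _ _ (Hg 0)), (Derive_ext _ _ _ H0),
    Derive_const in Hpos.
  lra.
Qed.

Lemma barrier_no_complete_geodesic (theta : R) (D : R * R -> Prop)
    (F : R * R -> R) (x y x' y' : R -> R) :
  0 <= theta -> is_barrier theta D F -> geodesic_coords x y x' y' ->
  (forall t, locally (x t, y t) D) -> (forall t, (x' t, y' t) <> (0, 0)) ->
  False.
Proof.
  intros Hth ((HF & _) & Hpos & Hgrad) H HD Hne.
  assert (HF2 : Ck 2 D F).
  { destruct HF as [Hc HF]; split; [exact Hc |]; intros i.
    destruct (HF i) as [He [Hci HF']]; split; [exact He | split; [exact Hci |]].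
    intros j; destruct (HF' j) as [Hej [Hcj _]]; repeat split; assumption. }
  pose proof (fun t => locally_singleton _ _ (HD t)) as HDp.
  apply (riccati_no_global (fun t => dir_deriv F (x t, y t) (x' t, y' t))
    (fun t => hess F (x t, y t) (x' t, y' t) (x' t, y' t)) theta); intros t.
  - apply (dir_deriv_geodesic D); auto.
  - apply Hpos; auto.
  - set (p := (x t, y t)); set (h := hess F p (x' t, y' t) (x' t, y' t)).
    assert (Hh : 0 < h) by (apply Hpos; [apply HDp | apply Hne]).
    assert (Hp : H2 p) by apply H.
    pose proof (sqrt_lt_R0 h Hh) as Hsh.
    (* The gradient bound is one-sided; using it for the velocity and its opposite, which share the
       Hessian value [h], bounds the absolute value. *)
    assert (Hbound : forall v, v <> (0, 0) -> hess F p v v = h ->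
      dir_deriv F p v <= sqrt theta * sqrt h).
    { intros v Hv Hhv.
      pose proof (Hgrad p v (HDp t) Hv) as Hg.
      rewrite inner_grad, Hhv in Hg by exact Hp.
      apply (Rmult_le_compat_r (sqrt h)) in Hg; [| lra].
      replace (dir_deriv F p v / sqrt h * sqrt h) with (dir_deriv F p v) in Hg
        by (field; lra).
      exact Hg. }
    pose proof (Hbound (x' t, y' t) (Hne t) eq_refl) as Hup.
    assert (Hlow : dir_deriv F p (- x' t, - y' t) <= sqrt theta * sqrt h).
    { apply Hbound.
      - intros E; injection E as Ex Ey.
        apply (Hne t); f_equal; lra.
      - unfold h, hess, sumc; simpl; ring. }
    replace (dir_deriv F p (- x' t, - y' t))
      with (- dir_deriv F p (x' t, y' t)) in Hlow
      by (unfold dir_deriv; simpl; ring).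
    replace (theta * h) with ((sqrt theta * sqrt h) ^ 2)
      by (rewrite Rpow_mult_distr, !pow2_sqrt by lra; reflexivity).
    apply pow_maj_Rabs, Rabs_le; lra.
Qed.

(** * Complete geodesics inside half-spaces *)

Lemma arc_circle (m r e : R) :
  (arc_x m r e - m) ^ 2 + arc_y r e ^ 2 = r ^ 2.
Proof.
  unfold arc_x, arc_y; field; nra.
Qed.

Lemma half_space_complete_geodesic (q v : R * R) :
  H2 q -> v <> (0, 0) ->
  exists x y x' y', geodesic_coords x y x' y' /\
    (forall t, (x' t, y' t) <> (0, 0)) /\
    forall t, half_space_form q v (x t, y t) < 0.
Proof.
  destruct q as [x0 y0], v as [v1 v2]; unfold H2; simpl; intros Hy Hv.
  destruct (Req_dec v2 0) as [-> | Hv2].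
  - assert (Hv1 : v1 <> 0) by (intros ->; apply Hv; reflexivity).
    (* The boundary is the vertical line through [q]; shifting it by [- v1] makes the form equal to
       [- 2 * y0 * v1 ^ 2]. *)
    do 4 eexists; split; [apply (vertical_geodesic (x0 - v1) 1 1 Rlt_0_1) |].
    split; intros t.
    + intros E; injection E as E.
      pose proof (exp_pos (1 * t)); lra.
    + unfold half_space_form; simpl.
      assert (0 < v1 * v1) by nra; nra.
  (* Centre and radius of the bounding half-circle, which passes through [q] with normal [v]. *)
  - set (m := x0 - y0 * v1 / v2).
    set (r := y0 * sqrt (1 + (v1 / v2) ^ 2)).
    assert (Hr : 0 < r).
    { apply Rmult_lt_0_compat; [exact Hy | apply sqrt_lt_R0].
      pose proof (pow2_ge_0 (v1 / v2)); lra. }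
    assert (Hr2 : r ^ 2 = y0 ^ 2 + (y0 * v1 / v2) ^ 2).
    { unfold r; rewrite Rpow_mult_distr, pow2_sqrt.
      - field; exact Hv2.
      - pose proof (pow2_ge_0 (v1 / v2)); lra. }
    assert (Hform : forall p, half_space_form (x0, y0) (v1, v2) p
                      = v2 * ((fst p - m) ^ 2 + snd p ^ 2 - r ^ 2)).
    { intros p; rewrite Hr2; unfold half_space_form, m; simpl.
      field; exact Hv2. }
    (* A concentric half-circle of radius [s] stays in the half-space: the outside when [v2 < 0],
       the inside when [v2 > 0]. *)
    assert (Hs : exists s, 0 < s /\ v2 * (s ^ 2 - r ^ 2) < 0).
    { destruct (Rlt_le_dec v2 0).
      - exists (2 * r); split; [lra |]; assert (0 < r * r) by nra; nra.
      - exists (r / 2); split; [lra |]; assert (0 < r * r) by nra; nra. }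
    destruct Hs as (s & Hs & Hsneg).
    pose proof (arc_geodesic m s 1 1 Hs Rlt_0_1) as Hg.
    do 4 eexists; split; [exact Hg |].
    split; intros t.
    + intros E; injection E as E _.
      destruct (Hg t) as [Ht _].
      apply (Rlt_not_eq 0 (1 * arc_y s (1 * exp (1 * t)) ^ 2 / s)); [| auto].
      apply Rmult_lt_0_compat; [| apply Rinv_0_lt_compat, Hs].
      rewrite Rmult_1_l; apply pow_lt, Ht.
    + rewrite Hform; cbn [fst snd]; rewrite arc_circle; exact Hsneg.
Qed.

Theorem corollary1p2 :
  forall D : R * R -> Prop, open_half_space D ->
  forall theta : R, 0 <= theta ->
  ~ exists F : R * R -> R, is_barrier theta D F.
Proof.
  intros D (q & v & Hq & Hv & HD) theta Hth [F HF].
  destruct (half_space_complete_geodesic q v Hq Hv)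
    as (x & y & x' & y' & Hg & Hne & HN).
  apply (barrier_no_complete_geodesic theta D F x y x' y' Hth HF Hg);
    [| exact Hne].
  intros t; eapply filter_imp;
    [| apply (half_space_form_open q v (x t, y t)); [apply Hg | apply HN]].
  intros z [Hz HNz]; apply HD; split; [exact Hz |].
  apply half_space_form_neg; assumption.
Qed.
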